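(* Fix $\theta\in\Theta$ and observations $X_1,\dots,X_n\in\mathcal X$. Assume that there exists some $R$ in the interior of $\mathcal{D}_\phi^{(n)}$ and in $\mathcal{M}_\theta^{(n)}$ such that, for all $Q$ in $\partial\mathcal{D}_\phi^{(n)}$ (the frontier of $\mathcal{D}_\phi^{(n)}$), $$\frac1n\sum_{i=1}^n\varphi\left(nR(X_i)\right)<\frac1n\sum_{i=1}^n\varphi\left(nQ(X_i)\right).$$ Then the following holds. (i) There exists a unique $\widehat{Q_\theta^*}$ in $\mathcal{M}_\theta^{(n)}$ such that $$\inf_{Q\in\mathcal{M}_\theta^{(n)}}\frac1n\sum_{i=1}^n\varphi\left(nQ(X_i)\right)=\frac1n\sum_{i=1}^n\varphi\left(n\widehat{Q_\theta^*}(X_i)\right).$$ (ii) $\widehat{Q_\theta^*}$ is an interior point of $\mathcal{D}_\phi^{(n)}$ and satisfies, for all $i=1,\dots,n$, $$\widehat{Q_\theta^*}(X_i)=\frac1n(\varphi')^{-1}\left(\widehat c_0+\sum_{j=1}^l\widehat c_j\,g_j(X_i,\theta)\right),$$ where $(\widehat c_0,\widehat c_1,\dots,\widehat c_l)^T$ is a solution of the system $$\frac1n\sum_{i=1}^n(\varphi')^{-1}\left(\widehat c_0+\sum_{k=1}^l\widehat c_k g_k(X_i,\theta)\right)=1,\qquad \frac1n\sum_{i=1}^n g_j(X_i,\theta)\,(\varphi')^{-1}\left(\widehat c_0+\sum_{k=1}^l\widehat c_k g_k(X_i,\theta)\right)=0,\quad j=1,\dots,l.$$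
   Context: $\mathcal X$ is a measurable space, $\Theta\subset\mathbb R^d$ is open, and $g=(g_1,\dots,g_l)^T:\mathcal X\times\Theta\to\mathbb R^l$; the functions $\mathbf 1_{\mathcal X},g_1,\dots,g_l$ are linearly independent. $\varphi:[-\infty,+\infty]\to[0,+\infty]$ is a convex function with $\varphi(1)=0$; its domain $D_\varphi=\{x:\varphi(x)<+\infty\}$ is an interval with endpoints $a<1<b$ (finite or infinite, included or not); $\varphi$ is strictly convex and $\mathcal C^2$ on the interior of $D_\varphi$; $\varphi(a),\varphi(b),\varphi'(a),\varphi'(b)$ are defined as the one-sided limits $\lim_{x\downarrow a}$, $\lim_{x\uparrow b}$ (possibly infinite). $(\varphi')^{-1}$ denotes the inverse function of $\varphi'$. Signed measures $Q$ absolutely continuous with respect to the empirical measure $P_n=\frac1n\sum_{i=1}^n\delta_{X_i}$ are identified with weight vectors $(Q(X_1),\dots,Q(X_n))^T\in\mathbb R^n$, so that the following sets are subsets of $\mathbb R^n$ (interior and frontier are taken in $\mathbb R^n$): $$\mathcal{M}_\theta^{(n)}=\left\{Q:\ \sum_{i=1}^nQ(X_i)=1,\ \sum_{i=1}^nQ(X_i)g(X_i,\theta)=0\right\},\qquad \mathcal{D}_\phi^{(n)}=\left\{Q:\ \frac1n\sum_{i=1}^n\varphi(nQ(X_i))<\infty\right\}.$$ *)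

(* Defs.v *)
From HB Require Import structures.
From mathcomp Require Import all_boot all_order all_algebra.
From mathcomp Require Import all_classical all_reals all_analysis.

Set Implicit Arguments.
Unset Strict Implicit.
Unset Printing Implicit Defensive.

Import Order.TTheory GRing.Theory Num.Theory.
Import numFieldNormedType.Exports.

Local Open Scope classical_set_scope.
Local Open Scope ring_scope.
Local Open Scope ereal_scope.

Section divergence_function.
Context {R : realType}.
Implicit Types (phi : \bar R -> \bar R) (a b : \bar R).

Definition edom phi : set (\bar R) := [set u | phi u < +oo].

Definition rdom phi : set R := [set u | phi u%:E < +oo].

(* The real-valued version of [phi]; only meaningful on [rdom phi]. *)
Definition rfun phi : R -> R := fun u => fine (phi u%:E).

(* Convexity on the extended line: the inequality is required exactly when the
   convex combination is not of the form (+oo) + (-oo). *)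
Definition ereal_convex phi : Prop :=
  forall (u v : \bar R) (t : R), (0 < t < 1)%R ->
    t%:E * u +? (1 - t)%:E * v ->
    phi (t%:E * u + (1 - t)%:E * v) <= t%:E * phi u + (1 - t)%:E * phi v.

Definition strictly_convex_on (I : set R) (f : R -> R) : Prop :=
  forall u v t : R, I u -> I v -> u != v -> (0 < t < 1)%R ->
    (f (t * u + (1 - t) * v) < t * f u + (1 - t) * f v)%R.

(* [f] is C^2 on the set [I], which is intended to be open. *)
Definition C2_on (I : set R) (f : R -> R) : Prop :=
  forall u : R, I u ->
    [/\ derivable f u 1%R, derivable (f^`())%classic u 1%R
      & {for u, continuous (f^`(2))%classic}].

Record is_divergence_function phi a b : Prop := IsDivergenceFunction {
  divf_ge0 : forall u, 0 <= phi u ;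
  divf_convex : ereal_convex phi ;
  divf_1 : phi 1 = 0 ;
  divf_lt1 : a < 1 ;
  divf_gt1 : 1 < b ;
  (* the booleans tell whether each endpoint belongs to the domain *)
  divf_dom : exists sa sb : bool,
    edom phi = [set` Interval (BSide sa a) (BSide sb b)] ;
  divf_strict : strictly_convex_on (rdom phi)° (rfun phi) ;
  divf_C2 : C2_on (rdom phi)° (rfun phi) ;
  divf_lima : phi u @[u --> within (fun u => a < u) (nbhs a)] --> phi a ;
  divf_limb : phi u @[u --> within (fun u => u < b) (nbhs b)] --> phi b }.

Definition dphi phi : R -> R := (rfun phi)^`()%classic.

(* The values taken by [phi'] on the interior of the domain, i.e. the points at
   which the inverse of [phi'] is defined. *)
Definition dphi_range phi : set R := dphi phi @` (rdom phi)°.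

(* The inverse function of [phi'], set to 0 outside [dphi_range phi]. *)
Definition dphi_inv phi : R -> R := 'pinv_(fun=> 0%R) (rdom phi)° (dphi phi).

End divergence_function.

Definition frontier {T : topologicalType} (A : set T) : set T :=
  closure A `\` A°.

(* Linear independence of 1, g_1, ..., g_l as functions on X x Theta. *)
Definition lin_indep_with_1 {R : realType} {X : Type} {d l : nat}
    (Theta : set 'cV[R]_d) (g : X -> 'cV[R]_d -> 'cV[R]_l) : Prop :=
  forall (c0 : R) (c : 'I_l -> R),
    (forall x theta, Theta theta ->
       c0 + \sum_(j < l) c j * g x theta j ord0 = 0)%R ->
    c0 = 0%R /\ forall j, c j = 0%R.

Section empirical.
Context {R : realType} {n : nat}.

(* A signed measure carried by the sample X_1, ..., X_n is represented by the
   column Q of its weights: [Q i ord0] stands for Q(X_i). *)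

Definition empirical_div (phi : \bar R -> \bar R) (Q : 'cV[R]_n) : \bar R :=
  (n%:R^-1)%:E * \sum_(i < n) phi (n%:R * Q i ord0)%:E.

Definition D_n (phi : \bar R -> \bar R) : set 'cV[R]_n :=
  [set Q | empirical_div phi Q < +oo].

Definition M_n {X : Type} {d l : nat} (g : X -> 'cV[R]_d -> 'cV[R]_l)
    (theta : 'cV[R]_d) (x : 'I_n -> X) : set 'cV[R]_n :=
  [set Q | (\sum_(i < n) Q i ord0 = 1)%R /\
           (\sum_(i < n) Q i ord0 *: g (x i) theta = 0)%R].

End empirical.

(* Main.v *)
Require Import Defs.
From HB Require Import structures.
From mathcomp Require Import all_boot all_order all_algebra.
From mathcomp Require Import all_classical all_reals all_analysis.
From mathcomp Require Import ring lra.

Set Implicit Arguments.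
Unset Strict Implicit.
Unset Printing Implicit Defensive.

Import Order.TTheory GRing.Theory Num.Theory.
Import numFieldNormedType.Exports.

Local Open Scope classical_set_scope.
Local Open Scope ring_scope.

(** Write J for the criterion [empirical_div phi], D for its domain [D_n phi]
    and M for the affine set of weights that satisfy the constraints.

    Existence. Strict convexity and [phi 1 = 0] make [phi] grow at least
    linearly away from 1 ([phi_sublevel_bounded]), so the part of M on which J
    does not exceed its value at the given point Q0 lies in a compact box whose
    sides stay between [a / n] and [b / n]. On that box J is continuous as an
    extended-real function, the endpoints being covered by the one-sided limits
    of [phi] ([empirical_div_continuous_within]); hence J attains its minimum
    over M ([exists_empirical_div_min]).

    Interiority and uniqueness. The value of J at a minimiser is at most J(Q0),
    which is below every value of J on the frontier of D, so a minimiser is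
    interior to D. There J is strictly convex ([empirical_div_strict_convex]),
    and the midpoint of two distinct minimisers would do better than both.

    Multipliers. At an interior minimiser the derivative of J vanishes along
    every direction tangent to M ([first_order_condition]): the vector of the
    [phi'(n Q(X_i))] is orthogonal to everything that is orthogonal to the
    constraint vectors, so it is a combination of them
    ([lagrange_multipliers]). A strictly convex function has an injective
    derivative ([dphi_inj]), so this relation can be solved for [n Q(X_i)], and
    the system satisfied by the coefficients restates that Q belongs to M. *)

(** * Derivatives of strictly convex functions *)

(** The difference quotients of [f] from [u] towards [v] at step [t] in (0, 1)
    are at most [f v - f u] by convexity, and their limit at 0+ is
    [f'(u) (v - u)]. *)
Lemma strictly_convex_tangent (R : realType) (I : set R) (f : R -> R)
    (u v : R) :
  strictly_convex_on I f -> I u -> I v -> derivable f u 1 ->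
  f^`()%classic u * (v - u) <= f v - f u.
Proof.
move=> cvxf Iu Iv dfu; have [->|uv] := eqVneq v u.
  by rewrite !subrr mulr0.
(* The segment from u to v, so that the quotient is the slope of f o p at 0. *)
pose p t : R := u + t * (v - u).
have p0 : p 0 = u by rewrite /p mul0r addr0.
have dfp : is_derive (p 0) 1 f (f^`()%classic u).
  by rewrite p0 derive1E; exact: DeriveDef.
have dp : is_derive (0 : R) 1 p (v - u).
  by apply: is_derive_eq; rewrite scaler0 !add0r mul1r /GRing.scale /= mulr1.
have [+ <-] := is_derive1_comp dfp dp.
move=> /cvg_dnbhs_at_right/cvgr_to_le; apply; near=> t.
rewrite /= [t *: 1]mulr1 addr0 p0.
have t01 : 0 < t < 1.
  by apply/andP; split; near: t; [exact: nbhs_right_gt|exact: nbhs_right_lt].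
rewrite -[t^-1 *: _]/(t^-1 * _) mulrC ler_pdivrMr; last by case/andP: t01.
have := cvxf v u t Iv Iu uv t01.
have -> : t * v + (1 - t) * u = p t by rewrite /p; ring.
by move=> /ltW h; lra.
Unshelve. all: by end_near. Qed.

(** Two equal slopes at [u] and [v] would give tangent lower bounds at the
    midpoint whose linear parts cancel, so that the value there would be at
    least the mean of [f u] and [f v]. *)
Lemma strictly_convex_derive1_inj (R : realType) (I : set R) (f : R -> R) :
  strictly_convex_on I f ->
  (forall u v, I u -> I v -> I (2^-1 * u + (1 - 2^-1) * v)) ->
  (forall u, I u -> derivable f u 1) ->
  {in I &, injective f^`()%classic}.
Proof.
move=> cvxf Im df u v /set_mem Iu /set_mem Iv duv; apply: contrapT => /eqP uv.
have half : 0 < (2^-1 : R) < 1 by lra.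
have lt_m := cvxf u v _ Iu Iv uv half.
have Imid := Im _ _ Iu Iv; move: Imid lt_m.
have -> : 2^-1 * u + (1 - 2^-1) * v = (u + v) / 2 by field.
set m : R := (u + v) / 2 => Imid lt_m.
have tan_u := strictly_convex_tangent cvxf Iu Imid (df _ Iu).
have tan_v := strictly_convex_tangent cvxf Iv Imid (df _ Iv).
rewrite duv in tan_u; move: (f^`()%classic v : R) tan_u tan_v => d tan_u tan_v.
have : d * (m - u) + d * (m - v) = 0.
  by rewrite -mulrDr (_ : m - u + (m - v) = 0) ?mulr0 // /m; field.
by move=> *; lra.
Qed.

(** * The divergence function on the real line *)

Section divergence_on_the_line.
Context {R : realType} (phi : \bar R -> \bar R) (a b : \bar R).
Hypothesis div_phi : is_divergence_function phi a b.

Lemma rdom_le (u : R) : rdom phi u -> (a <= u%:E <= b)%E.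
Proof.
move=> hu; have [sa [sb dom]] := divf_dom div_phi.
have : edom phi u%:E by [].
rewrite dom /= in_itv /= => /andP[h1 h2]; apply/andP; split.
  by case: sa h1 {dom} => //= /ltW.
by case: sb h2 {dom} => //= /ltW.
Qed.

Lemma rdom_lt (u : R) : (a < u%:E < b)%E -> rdom phi u.
Proof.
move=> /andP[au ub]; have [sa [sb dom]] := divf_dom div_phi.
suff : edom phi u%:E by [].
rewrite dom /= in_itv /=.
by apply/andP; split; [case: (sa)|case: (sb)] => //=; apply: ltW.
Qed.

Lemma open_strictly_between : open [set u : R | (a < u%:E < b)%E].
Proof.
have -> : [set u : R | (a < u%:E < b)%E] =
    [set u | (a < u%:E)%E] `&` [set u | (u%:E < b)%E].
  by apply/seteqP; split=> u /=; [move=> /andP[]|move=> [-> ->]].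
by apply: openI; [exact: open_ereal_gt|exact: open_ereal_lt].
Qed.

Lemma rdom_interior (u : R) : (a < u%:E < b)%E -> (rdom phi)° u.
Proof.
move=> abu; have := open_strictly_between; rewrite openE => /(_ u abu).
by apply: filterS => v; exact: rdom_lt.
Qed.

Lemma interior_rdom_lt (u : R) : (rdom phi)° u -> (a < u%:E < b)%E.
Proof.
move=> /nbhs_ballP[e /= e0 he].
have /rdom_le/andP[_ h1] : rdom phi (u + e / 2).
  by apply: he; rewrite /ball /= opprD addNKr normrN gtr0_norm; lra.
have /rdom_le/andP[h2 _] : rdom phi (u - e / 2).
  by apply: he; rewrite /ball /= opprB addrCA subrr addr0 gtr0_norm; lra.
by rewrite (le_lt_trans h2) ?(lt_le_trans _ h1) // lte_fin; lra.
Qed.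

Lemma rfunE (u : R) : rdom phi u -> phi u%:E = (rfun phi u)%:E.
Proof.
by move=> hu; rewrite /rfun fineK // ge0_fin_numE // (divf_ge0 div_phi).
Qed.

Lemma interior_rdom_convex (u v t : R) : 0 < t < 1 ->
  (rdom phi)° u -> (rdom phi)° v -> (rdom phi)° (t * u + (1 - t) * v).
Proof.
move=> t01 /interior_rdom_lt/andP[au ub] /interior_rdom_lt/andP[av vb].
apply: rdom_interior; wlog uv : u v t t01 au ub av vb / u <= v => [hw|].
  have [|/ltW vu] := leP u v; first exact: hw.
  have -> : t * u + (1 - t) * v = (1 - t) * v + (1 - (1 - t)) * u by ring.
  by apply: hw => //; lra.
apply/andP; split.
  by apply: lt_le_trans au _; rewrite lee_fin; nra.
by apply: le_lt_trans vb; rewrite lee_fin; nra.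
Qed.

Lemma dphi_inj : {in ((rdom phi)° : set R) &, injective (dphi phi)}.
Proof.
apply: strictly_convex_derive1_inj (divf_strict div_phi) _ _ => [u v|u].
  by apply: interior_rdom_convex; lra.
by case/(divf_C2 div_phi).
Qed.

Lemma rdom1 : (rdom phi)° 1.
Proof.
by apply: rdom_interior; rewrite (divf_lt1 div_phi) (divf_gt1 div_phi).
Qed.

(** By strict convexity the value at the midpoint of [u] and 1 is below
    [phi u / 2], and it is nonnegative. *)
Lemma phi_interior_gt0 (u : R) : (rdom phi)° u -> u != 1 -> 0 < rfun phi u.
Proof.
move=> du u1; have half : 0 < (2^-1 : R) < 1 by lra.
have := divf_strict div_phi du rdom1 u1 half.
rewrite {3}/rfun (divf_1 div_phi) /=; set m := (X in rfun _ X).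
have : 0 <= rfun phi m by rewrite fine_ge0 // (divf_ge0 div_phi).
lra.
Qed.

(** The graph at [1 / k] of the way from 1 to [u] lies on or below the chord,
    and [phi 1 = 0]. This uses convexity on the whole domain, as [u] may be an
    endpoint. *)
Lemma phi_chord (k u : R) : 1 <= k -> rdom phi u ->
  rfun phi (1 + (u - 1) / k) <= rfun phi u / k.
Proof.
rewrite le_eqVlt => /predU1P[<- _|k1 du]; first by rewrite !divr1 addrC subrK.
have k0 : 0 < k by lra.
have t01 : 0 < k^-1 < 1 by rewrite invr_gt0 k0 invf_lt1.
have := @divf_convex _ _ _ _ div_phi u%:E 1%E _ t01.
have arg : (k^-1%:E * u%:E + (1 - k^-1)%:E * 1 = (1 + (u - 1) / k)%:E)%E.
  by rewrite -!EFinM -EFinD; congr (_%:E); field; lra.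
rewrite arg (divf_1 div_phi) mule0 adde0 rfunE // -EFinM => /(_ isT) h.
by rewrite [X in _ <= X]mulrC -lee_fin -rfunE // /rdom /= (le_lt_trans h) ?ltry.
Qed.

(** In the interior [phi] is differentiable; at an endpoint the limit is the one
    prescribed by the definition of a divergence function, even when the value
    there is infinite. Seen as extended-real valued on the closed interval,
    [phi] is thus continuous, although it may jump just outside. *)
Lemma phi_cvg_within (u : R) : (a <= u%:E <= b)%E ->
  phi v%:E @[v --> within [set v : R | (a <= v%:E <= b)%E] (nbhs u)]
    --> phi u%:E.
Proof.
move=> /andP[]; rewrite !le_eqVlt => /predU1P[ua _|au /predU1P[ub|ub]].
- move=> P Pu; rewrite -ua in Pu.
  have := divf_lima div_phi Pu; rewrite ua => /nbhs_EFin /=.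
  apply: filterS => v Pv /andP[]; rewrite le_eqVlt => /predU1P[va _|/Pv//].
  by rewrite /= -va -?ua; exact: nbhs_singleton.
- move=> P Pu; rewrite ub in Pu.
  have := divf_limb div_phi Pu; rewrite -ub => /nbhs_EFin /=.
  apply: filterS => v Pv /andP[_]; rewrite le_eqVlt => /predU1P[vb|/Pv//].
  by rewrite /= vb ?ub; exact: nbhs_singleton.
- have abu : (a < u%:E < b)%E by rewrite au.
  apply: cvg_within_filter; rewrite rfunE; last exact: rdom_lt.
  have [du _ _] := divf_C2 div_phi (rdom_interior abu).
  have /differentiable_continuous cu := (derivable1_diffP _ _).1 du.
  apply: cvg_EFin cu; near=> v.
  rewrite ge0_fin_numE ?(divf_ge0 div_phi) //.
  by near: v; exact: rdom_interior.
Unshelve. all: by end_near. Qed.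

(** Coercivity. With [m > 0] the smaller of the values of [phi] at [1 - e] and
    [1 + e], the chord inequality applied at distance [e] from 1 gives
    [phi u >= m |u - 1| / e] as soon as [|u - 1| >= e]. *)
Lemma phi_sublevel_bounded (C : R) :
  exists M : R, forall u : R, (phi u%:E <= C%:E)%E -> `|u| <= M.
Proof.
have := rdom1 => /nbhs_interior/nbhs_ballP[e0 /= e00 he0].
pose e := e0 / 2; have e_gt0 : 0 < e by rewrite divr_gt0.
have [dr dl] : (rdom phi)° (1 + e) /\ (rdom phi)° (1 - e).
  split; apply: he0; rewrite /ball /=.
    by rewrite opprD addNKr normrN gtr0_norm // /e; lra.
  by rewrite opprB addrCA subrr addr0 gtr0_norm // /e; lra.
pose m := Num.min (rfun phi (1 + e)) (rfun phi (1 - e)).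
have m_gt0 : 0 < m.
  rewrite lt_min; apply/andP.
  by split; apply: phi_interior_gt0 => //; apply/eqP; lra.
exists (1 + e + e * (`|C| / m)) => u uC.
have du : rdom phi u by exact: le_lt_trans uC (ltry _).
have {}uC : rfun phi u <= C by rewrite -lee_fin -rfunE.
have Cm : 0 <= `|C| / m by rewrite divr_ge0 // ltW.
suff : `|u - 1| <= e + e * (`|C| / m).
  have := ler_normB (u - 1) (- 1); rewrite opprK subrK normrN normr1; lra.
have [ue|ue] := leP `|u - 1| e; first by nra.
have u1 : u - 1 != 0 by rewrite -normr_gt0; lra.
have k1 : 1 <= `|u - 1| / e by rewrite ler_pdivlMr // mul1r ltW.
have k0 : 0 < `|u - 1| / e by lra.
(* Going the fraction e / |u - 1| of the way to u reaches 1 + e or 1 - e. *)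
have := phi_chord k1 du.
have mle : m <= rfun phi (1 + (u - 1) / (`|u - 1| / e)).
  have [u0|u0] := ltP 0 (u - 1).
    rewrite gtr0_norm //.
    have -> : 1 + (u - 1) / ((u - 1) / e) = 1 + e.
      by field; apply/andP; split; lra.
    by rewrite ge_min lexx.
  rewrite ler0_norm //.
  have -> : 1 + (u - 1) / (- (u - 1) / e) = 1 - e.
    by field; rewrite u1; lra.
  by rewrite ge_min lexx orbT.
move=> /(le_trans mle); rewrite ler_pdivlMr // => mk.
have : m * (`|u - 1| / e) <= `|C|.
  exact: le_trans mk (le_trans uC (ler_norm _)).
rewrite mulrC -ler_pdivlMr // ler_pdivrMr // mulrC; lra.
Qed.

Lemma dphi_invK (u : R) : (rdom phi)° u -> dphi_inv phi (dphi phi u) = u.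
Proof. by move=> du; apply: pinvKV; [exact: dphi_inj|exact: mem_set]. Qed.

End divergence_on_the_line.

(** * Compactness and linear algebra for column vectors *)

(** The image is compact, hence closed in the extended line, so it contains its
    infimum. *)
Lemma compact_ereal_EVT_min (T : topologicalType) (R : realType)
    (f : T -> \bar R) (A : set T) :
  A !=set0 -> compact A -> {within A, continuous f} ->
  exists2 c, A c & forall t, A t -> (f c <= f t)%E.
Proof.
move=> /(image_nonempty f) /set0P fA0 cA cf.
have clfA : closed (f @` A).
  by apply: compact_closed (@ereal_hausdorff R) _; exact: continuous_compact.
have [u fAu u_inf] := ereal_inf_seq fA0.
have [c Ac fc] : (f @` A) (ereal_inf (f @` A)).
  by apply: closed_cvg clfA _ _ u_inf; exact: nearW.
by exists c => // t At; rewrite fc; apply: ereal_inf_lbound; exists t.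
Qed.

Lemma trmx_continuous (T : topologicalType) m n :
  continuous (@trmx T m n).
Proof.
move=> M A [P MP PA]; exists (fun i j => P j i).
  by move=> i j; have := MP j i; rewrite mxE.
by move=> N NP; apply: PA => i j; rewrite mxE; exact: NP.
Qed.

Lemma cV_compact (R : realType) n (A : 'I_n -> set R) :
  (forall i, compact (A i)) ->
  compact [set v : 'cV[R]_n | forall i, A i (v i ord0)].
Proof.
move=> cA; have := rV_compact cA => /(continuous_compact (f := @trmx R 1 n)).
set B := trmx @` _; suff -> : B = [set v | forall i, A i (v i ord0)].
  by apply; apply: continuous_subspaceT; exact: trmx_continuous.
apply/seteqP; split=> [_ [v Av <-] i|v Av]; first by rewrite mxE; exact: Av.
by exists v^T; rewrite ?trmxK // => i; rewrite mxE; exact: Av.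
Qed.

Lemma closed_hyperplane (R : realType) n (w : 'I_n -> R) (c : R) :
  closed [set v : 'cV[R]_n | \sum_(i < n) v i ord0 * w i = c].
Proof.
apply: (@preimage_closed _ _ _ [set y : R | y = c]); last exact: closed_eq.
move=> + _; apply: continuous_big => [|i _ v].
  by move=> p; exact: add_continuous.
apply: cvgMr_tmp; first exact: (nbhs_filter v).
exact: (@coord_continuous R n 1 i ord0 v).
Qed.

(** A vector orthogonal to the kernel of [B] lies in the row space of [B]: the
    columns of [cokermx B] belong to that kernel, and the row space is the set
    of the vectors orthogonal to all of them. *)
Lemma submx_of_kernel (F : fieldType) m n (B : 'M[F]_(m, n)) (y : 'rV[F]_n) :
  (forall h : 'cV[F]_n, B *m h = 0 -> y *m h = 0) -> (y <= B)%MS.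
Proof.
move=> ker; rewrite submxE; apply/eqP/matrixP => i j.
have := ker (col j (cokermx B)).
rewrite colE (mulmxA B) (mulmxA y) mulmx_coker mul0mx => /(_ erefl).
by rewrite -colE => /matrixP/(_ i 0); rewrite !mxE.
Qed.

(** * The divergence on a sample *)

Section divergence_on_the_sample.
Context {R : realType} (phi : \bar R -> \bar R) (a b : \bar R).
Context {n : nat}.
Hypothesis n_gt0 : (0 < n)%N.
Hypothesis div_phi : is_divergence_function phi a b.
Implicit Types (Q h : 'cV[R]_n).

Let nR_gt0 : 0 < n%:R :> R. Proof. by rewrite ltr0n. Qed.

Lemma phi_le_empirical_div Q i :
  (phi (n%:R * Q i ord0)%:E <= n%:R%:E * empirical_div phi Q)%E.
Proof.
rewrite /empirical_div muleA -EFinM divff ?gt_eqF // mul1e (bigD1 i) //=.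
by rewrite leeDl // sume_ge0 // => j _; exact: (divf_ge0 div_phi).
Qed.

Lemma empirical_divE Q : (forall i, rdom phi (n%:R * Q i ord0)) ->
  empirical_div phi Q = (n%:R^-1 * \sum_(i < n) rfun phi (n%:R * Q i ord0))%:E.
Proof.
move=> dQ; rewrite /empirical_div EFinM -sumEFin; congr (_ * _)%E.
by apply: eq_bigr => i _; rewrite (rfunE div_phi).
Qed.

Lemma D_n_rdom Q i : D_n phi Q -> rdom phi (n%:R * Q i ord0).
Proof.
move=> dQ; apply: le_lt_trans (phi_le_empirical_div Q i) _.
by rewrite lte_mul_pinfty // lee_fin ltW.
Qed.

Lemma line_continuous Q h : continuous (fun t : R => Q + t *: h).
Proof. by move=> t; apply: cvgD; [exact: cvg_cst|exact: cvgZr_tmp]. Qed.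

(** Moving the [i]-th weight alone stays in a neighbourhood of [Q]. *)
Lemma interior_D_n_rdom Q i :
  (D_n phi)° Q -> (rdom phi)° (n%:R * Q i ord0).
Proof.
move=> dQ.
(* Adding p u to the i-th weight turns n Q(X_i) into u. *)
pose p (u : R) : R := n%:R^-1 * u - Q i ord0.
pose l u : 'cV[R]_n := Q + p u *: delta_mx i ord0.
have pQ : p (n%:R * Q i ord0) = 0.
  by rewrite /p mulrA mulVf ?gt_eqF // mul1r subrr.
have cp : p u @[u --> n%:R * Q i ord0] --> p (n%:R * Q i ord0).
  by apply: cvgB; [exact: mulrl_continuous|exact: cvg_cst].
have := cvg_comp _ _ cp (@line_continuous Q (delta_mx i ord0) _).
rewrite pQ scale0r addr0 => /(_ _ dQ) dl.
have {}dl : \forall u \near n%:R * Q i ord0, D_n phi (l u) by exact: dl.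
apply: filterS dl => u /= /(D_n_rdom i).
by rewrite !mxE !eqxx mulr1 addrC subrK mulrA mulfV ?gt_eqF // mul1r.
Qed.

(** Strictness comes from one coordinate where [Q] and [Q'] differ; the others
    contribute at least a weak inequality. *)
Lemma empirical_div_strict_convex Q Q' (t : R) : 0 < t < 1 -> Q != Q' ->
  (forall i, (rdom phi)° (n%:R * Q i ord0)) ->
  (forall i, (rdom phi)° (n%:R * Q' i ord0)) ->
  (empirical_div phi (t *: Q + (1 - t) *: Q')
     < t%:E * empirical_div phi Q + (1 - t)%:E * empirical_div phi Q')%E.
Proof.
move=> t01 QQ' dQ dQ'.
have midE i : n%:R * (t *: Q + (1 - t) *: Q') i ord0
    = t * (n%:R * Q i ord0) + (1 - t) * (n%:R * Q' i ord0).
  by rewrite !mxE; ring.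
have dmid i : (rdom phi)° (n%:R * (t *: Q + (1 - t) *: Q') i ord0).
  by rewrite midE; exact: (interior_rdom_convex div_phi).
rewrite (empirical_divE (fun i => interior_subset (dmid i))).
rewrite (empirical_divE (fun i => interior_subset (dQ i))).
rewrite (empirical_divE (fun i => interior_subset (dQ' i))).
rewrite -!EFinM -EFinD lte_fin mulrCA [X in _ < _ + X]mulrCA -mulrDr.
rewrite ltr_pM2l ?invr_gt0 // !mulr_sumr -big_split /=.
have [i0 Qi0] : exists i, Q i ord0 != Q' i ord0.
  apply: contrapT => /forallNP QQ'eq; move/eqP: QQ'; apply.
  by apply/matrixP => i j; rewrite (ord1 j); apply/eqP/negPn/negP; exact: QQ'eq.
have strict i : Q i ord0 != Q' i ord0 ->
    rfun phi (n%:R * (t *: Q + (1 - t) *: Q') i ord0) <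
    t * rfun phi (n%:R * Q i ord0) + (1 - t) * rfun phi (n%:R * Q' i ord0).
  move=> Qi; rewrite midE; apply: (divf_strict div_phi) => //.
  by apply: contra_neq Qi; apply: mulfI; rewrite gt_eqF.
rewrite (bigD1 i0) //= [ltRHS](bigD1 i0) //=.
apply: ltr_leD; first exact: strict.
apply: ler_sum => i _.
have [Qi|/strict/ltW //] := eqVneq (Q i ord0) (Q' i ord0).
by rewrite midE Qi -!mulrDl addrC subrK !mul1r.
Qed.

(** Fermat's rule for the restriction of the divergence to the line through [Q]
    directed by [h], which is a finite sum of differentiable functions as long
    as the line stays in the interior of the domain. *)
Lemma first_order_condition Q h : (D_n phi)° Q ->
  (forall t : R, (empirical_div phi Q <= empirical_div phi (Q + t *: h))%E) ->
  \sum_(i < n) dphi phi (n%:R * Q i ord0) * h i ord0 = 0.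
Proof.
move=> dQ Qmin.
have /nbhs_ballP[e /= e_gt0 be] :
    \forall t \near (0 : R), (D_n phi)° (Q + t *: h).
  have /nbhs_interior := dQ; rewrite -{1}[Q]addr0 -(scale0r h).
  exact: line_continuous.
have {}be t : t \in `](- e), e[ -> (D_n phi)° (Q + t *: h).
  rewrite in_itv /= => te; apply: be.
  by rewrite /ball /= sub0r normrN ltr_norml.
pose F i (t : R) : R := rfun phi (n%:R * (Q + t *: h) i ord0).
have dF i t : t \in `](- e), e[ ->
    is_derive t 1 (F i)
      (dphi phi (n%:R * (Q + t *: h) i ord0) * (n%:R * h i ord0)).
  move=> /be /(interior_D_n_rdom i) /(divf_C2 div_phi) [dphi_i _ _].
  pose p t := n%:R * Q i ord0 + t * (n%:R * h i ord0).
  have pE s : n%:R * (Q + s *: h) i ord0 = p s by rewrite !mxE /p; ring.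
  have -> : F i = rfun phi \o p by apply/funext => s; rewrite /F /= pE.
  rewrite pE in dphi_i *; apply: is_derive1_comp.
    by rewrite /dphi derive1E; exact: DeriveDef.
  by apply: is_derive_eq; rewrite scaler0 !add0r mul1r /GRing.scale /= mulr1.
have dS t : t \in `](- e), e[ -> is_derive t 1 (\sum_(i < n) F i)
    (\sum_(i < n) dphi phi (n%:R * (Q + t *: h) i ord0) * (n%:R * h i ord0)).
  by move=> te; apply: is_derive_sum => i; exact: dF.
have e0 : 0 \in `](- e), e[ by rewrite in_itv /=; lra.
have SE t : (\sum_(i < n) F i) t = \sum_(i < n) F i t.
  by rewrite fct_sumE.
have [_ d0] : is_derive (0 : R) 1 (\sum_(i < n) F i) 0.
  apply: (@derive1_at_min _ _ (- e) e) => // [|t te|t te].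
  - by rewrite ltW // gtrN.
  - by case: (dS _ te).
  - have := Qmin t; rewrite !SE /F scale0r addr0 !empirical_divE.
    + by rewrite lee_fin ler_pM2l // invr_gt0.
    + by move=> i; apply: interior_subset; apply: interior_D_n_rdom; exact: be.
    + by move=> i; apply: interior_subset; exact: interior_D_n_rdom.
have [_] := dS _ e0; rewrite d0 scale0r addr0 => /esym.
rewrite (eq_bigr _ (fun i _ => mulrCA _ _ _)).
by rewrite -mulr_sumr => /eqP; rewrite mulf_eq0 gt_eqF //= => /eqP.
Qed.

(** Continuity can only be asked within a set of weights that keeps each
    [n Q(X_i)] in the closed interval: the divergence may jump to infinity when
    leaving the domain through a finite endpoint. *)
Lemma empirical_div_continuous_within (K : set 'cV[R]_n) :
  (forall Q i, K Q -> (a <= (n%:R * Q i ord0)%:E <= b)%E) ->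
  {within K, continuous (empirical_div phi : 'cV[R]_n -> \bar R)}.
Proof.
move=> Kab; apply/subspace_continuousP => Q KQ.
have within_proper : ProperFilter (within K (nbhs Q)).
  by apply: within_nbhs_proper; exact: subset_closure.
apply: cvgeZl => //; apply: cvg_nnesum => i _.
  by apply: nearW => Q'; exact: (divf_ge0 div_phi).
move=> P Pphi.
have near_ab := phi_cvg_within div_phi (Kab Q i KQ) Pphi.
have cQ : (fun Q' : 'cV[R]_n => n%:R * Q' i ord0) @ Q --> n%:R * Q i ord0.
  apply: cvgMl_tmp; first exact: (nbhs_filter Q).
  exact: (@coord_continuous R n 1 i ord0 Q).
have {}near_ab : nbhs Q [set Q' : 'cV[R]_n |
    (a <= (n%:R * Q' i ord0)%:E <= b)%E -> P (phi (n%:R * Q' i ord0)%:E)].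
  exact: (cQ _ near_ab).
by apply: filterS near_ab => Q' PQ' KQ'; apply: PQ'; exact: Kab.
Qed.

(** By coercivity, the points of [M] at which the divergence does not exceed its
    value at [Q0] lie in a compact set [K] on which the divergence is
    continuous; its minimum over [K] is then a minimum over [M]. *)
Lemma exists_empirical_div_min (M : set 'cV[R]_n) (Q0 : 'cV[R]_n) :
  closed M -> M Q0 -> D_n phi Q0 ->
  exists2 Qs, M Qs &
    forall Q, M Q -> (empirical_div phi Qs <= empirical_div phi Q)%E.
Proof.
move=> clM MQ0 dQ0.
have [r rQ0] : exists r : R, empirical_div phi Q0 = r%:E.
  by rewrite empirical_divE; [eexists|move=> i; exact: D_n_rdom].
have [B phiB] := phi_sublevel_bounded div_phi (n%:R * r).
pose A := `[- (B / n%:R), B / n%:R] `&`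
  ((fun u : R => (n%:R * u)%:E) @^-1` [set y | (a <= y)%E] `&`
   (fun u : R => (n%:R * u)%:E) @^-1` [set y | (y <= b)%E]).
have cmul : continuous (fun u : R => (n%:R * u)%:E).
  by move=> u; apply: cvg_EFin; [exact: nearW|exact: mulrl_continuous].
have cA : compact A.
  apply: compact_closedI; first exact: segment_compact.
  by apply: closedI; apply: preimage_closed => [u _|];
    first [exact: cmul | exact: closed_ereal_le_ereal
          | exact: closed_ereal_ge_ereal].
pose K := [set Q : 'cV[R]_n | forall i, A (Q i ord0)] `&` M.
have sub_K Q : M Q -> (empirical_div phi Q <= r%:E)%E -> K Q.
  move=> MQ Qr; split=> // i.
  have phiQ : (phi (n%:R * Q i ord0)%:E <= (n%:R * r)%:E)%E.
    apply: le_trans (phi_le_empirical_div Q i) _.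
    by rewrite EFinM lee_wpmul2l // lee_fin ltW.
  have /andP[aQ Qb] : (a <= (n%:R * Q i ord0)%:E <= b)%E.
    by apply: (rdom_le div_phi); exact: le_lt_trans phiQ (ltry _).
  split; last by split.
  have := phiB _ phiQ; rewrite normrM gtr0_norm // mulrC -ler_pdivlMr //.
  by rewrite ler_norml /= in_itv.
have K0 : K !=set0 by exists Q0; apply: sub_K => //; rewrite rQ0.
have cK : compact K.
  by apply: compact_closedI => //; exact: (cV_compact (fun=> cA)).
have [Qs [_ MQs] Qsmin] : exists2 Qs, K Qs &
    forall Q, K Q -> (empirical_div phi Qs <= empirical_div phi Q)%E.
  apply: compact_ereal_EVT_min => //; apply: empirical_div_continuous_within.
  by move=> Q i [/(_ i)[_ [aQ Qb]] _]; apply/andP.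
exists Qs => // Q MQ; have [Qr|/ltW rQ] := leP (empirical_div phi Q) r%:E.
  by apply: Qsmin; exact: sub_K.
apply: le_trans rQ; rewrite -rQ0; apply: Qsmin.
by apply: sub_K => //; rewrite rQ0.
Qed.

End divergence_on_the_sample.

(** * The moment constraints *)

Section moment_constraints.
Context {R : realType} {X : Type} {d l n : nat}.
Context (g : X -> 'cV[R]_d -> 'cV[R]_l) (theta : 'cV[R]_d) (x : 'I_n -> X).

Lemma M_nP (Q : 'cV[R]_n) : M_n g theta x Q <->
  \sum_(i < n) Q i ord0 = 1 /\
  forall j, \sum_(i < n) Q i ord0 * g (x i) theta j ord0 = 0.
Proof.
have sumE j : (\sum_(i < n) Q i ord0 *: g (x i) theta) j ord0 =
    \sum_(i < n) Q i ord0 * g (x i) theta j ord0.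
  by rewrite summxE; apply: eq_bigr => i _; rewrite mxE.
split=> -[Q1 Qg]; split=> //; first by move=> j; rewrite -sumE Qg mxE.
by apply/matrixP => j k; rewrite (ord1 k) sumE Qg mxE.
Qed.

Lemma closed_M_n : closed (M_n g theta x).
Proof.
have -> : M_n g theta x = [set Q | \sum_(i < n) Q i ord0 * 1 = 1] `&`
    \bigcap_(j in setT)
      [set Q | \sum_(i < n) Q i ord0 * g (x i) theta j ord0 = 0].
  apply/seteqP; split=> Q; rewrite /= -mulr_suml mulr1.
    by move=> /M_nP[Q1 Qg]; split=> // j _; exact: Qg.
  by move=> [Q1 Qg]; apply/M_nP; split=> // j; exact: Qg.
apply: closedI; first exact: closed_hyperplane.
by apply: closed_bigI => j _; exact: closed_hyperplane.
Qed.

Lemma M_n_convex (Q Q' : 'cV[R]_n) (t : R) :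
  M_n g theta x Q -> M_n g theta x Q' -> M_n g theta x (t *: Q + (1 - t) *: Q').
Proof.
move=> /M_nP[Q1 Qg] /M_nP[Q'1 Q'g].
have lin w : \sum_(i < n) (t *: Q + (1 - t) *: Q') i ord0 * w i =
    t * (\sum_(i < n) Q i ord0 * w i) +
    (1 - t) * (\sum_(i < n) Q' i ord0 * w i).
  rewrite !mulr_sumr -big_split; apply: eq_bigr => i _.
  by rewrite !mxE /=; ring.
apply/M_nP; split=> [|j]; last by rewrite lin Qg Q'g !mulr0 addr0.
have := lin (fun=> 1); rewrite -!mulr_suml !mulr1 Q1 Q'1 => ->; ring.
Qed.

Lemma M_n_translate (Q h : 'cV[R]_n) (t : R) : M_n g theta x Q ->
  \sum_(i < n) h i ord0 = 0 ->
  (forall j, \sum_(i < n) h i ord0 * g (x i) theta j ord0 = 0) ->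
  M_n g theta x (Q + t *: h).
Proof.
move=> /M_nP[Q1 Qg] h1 hg.
have lin w : \sum_(i < n) (Q + t *: h) i ord0 * w i =
    \sum_(i < n) Q i ord0 * w i + t * (\sum_(i < n) h i ord0 * w i).
  by rewrite mulr_sumr -big_split; apply: eq_bigr => i _; rewrite !mxE /=; ring.
apply/M_nP; split=> [|j]; last by rewrite lin Qg hg mulr0 addr0.
have := lin (fun=> 1); rewrite -!mulr_suml !mulr1 Q1 h1 => ->; ring.
Qed.

(** The constraint vectors are the rows of the matrix [col_mx 1 G], and its
    kernel is the space of directions tangent to the constraints. *)
Lemma lagrange_multipliers (y : 'I_n -> R) :
  (forall h : 'cV[R]_n, \sum_(i < n) h i ord0 = 0 ->
     (forall j, \sum_(i < n) h i ord0 * g (x i) theta j ord0 = 0) ->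
     \sum_(i < n) y i * h i ord0 = 0) ->
  exists (c0 : R) (c : 'I_l -> R),
    forall i, y i = c0 + \sum_(j < l) c j * g (x i) theta j ord0.
Proof.
move=> y_orth.
pose G : 'M[R]_(l, n) := \matrix_(j, i) g (x i) theta j ord0.
have : (\row_i y i <= col_mx (const_mx 1 : 'rV[R]_n) G)%MS.
  apply: submx_of_kernel => h; rewrite mul_col_mx => /eqP.
  rewrite col_mx_eq0 => /andP[/eqP h1 /eqP hG].
  apply/matrixP => i k; rewrite !mxE (ord1 k).
  under eq_bigr do rewrite mxE.
  apply: y_orth => [|j].
    have /matrixP/(_ ord0 ord0) := h1; rewrite !mxE => h10; rewrite -[RHS]h10.
    by apply: eq_bigr => s _; rewrite mxE mul1r.
  have /matrixP/(_ j ord0) := hG; rewrite !mxE => hG0; rewrite -[RHS]hG0.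
  by apply: eq_bigr => s _; rewrite mxE mulrC.
move=> /submxP[w yw].
exists (lsubmx w ord0 ord0), (fun j => rsubmx w ord0 j) => i.
have /rowP/(_ i) := yw.
rewrite -[in RHS](hsubmxK w) mul_row_col !mxE big_ord1 !mxE mulr1 => ->.
by congr (_ + _); apply: eq_bigr => j _; rewrite !mxE.
Qed.

End moment_constraints.

(** * Minimisation of the divergence under the constraints *)

Theorem proposition2p1 (R : realType)
    (disp : measure_display) (X : measurableType disp) (d l n : nat)
    (Theta : set 'cV[R]_d) (g : X -> 'cV[R]_d -> 'cV[R]_l)
    (phi : \bar R -> \bar R) (a b : \bar R)
    (theta : 'cV[R]_d) (x : 'I_n -> X) :
  open Theta ->
  lin_indep_with_1 Theta g ->
  is_divergence_function phi a b ->
  Theta theta ->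
  (exists Q0 : 'cV[R]_n,
     [/\ (D_n phi)° Q0, M_n g theta x Q0 &
         forall Q : 'cV[R]_n, frontier (D_n phi) Q ->
           (empirical_div phi Q0 < empirical_div phi Q)%E]) ->
  exists Qs : 'cV[R]_n,
    [/\ (* (i) *)
        M_n g theta x Qs
          /\ ereal_inf [set empirical_div phi Q | Q in M_n g theta x]
             = empirical_div phi Qs,
        (forall Q : 'cV[R]_n, M_n g theta x Q ->
           ereal_inf [set empirical_div phi Q' | Q' in M_n g theta x]
             = empirical_div phi Q -> Q = Qs),
        (* (ii) *)
        (D_n phi)° Qs &
        exists (c0 : R) (c : 'I_l -> R),
          let arg i := c0 + \sum_(j < l) c j * g (x i) theta j ord0 in
          [/\ (forall i : 'I_n, dphi_range phi (arg i)),
              (forall i : 'I_n, Qs i ord0 = n%:R^-1 * dphi_inv phi (arg i)),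
              n%:R^-1 * (\sum_(i < n) dphi_inv phi (arg i)) = 1 &
              forall j : 'I_l,
                n%:R^-1 * (\sum_(i < n)
                  g (x i) theta j ord0 * dphi_inv phi (arg i)) = 0]].
Proof.
move=> _ _ div_phi _ [Q0 [dQ0 MQ0 Q0_frontier]].
(* An empty sample cannot carry total mass 1. *)
have n_gt0 : (0 < n)%N.
  have /M_nP[+ _] := MQ0; case: (n) Q0 {dQ0 MQ0 Q0_frontier} => // Q0.
  by rewrite big_ord0 => /eqP; rewrite eq_sym oner_eq0.
have nR_neq0 : n%:R != 0 :> R by rewrite pnatr_eq0 -lt0n.
have [Qs MQs Qs_min] := exists_empirical_div_min n_gt0 div_phi
  (@closed_M_n R X d l n g theta x) MQ0 (interior_subset dQ0).
have min_interior Q : M_n g theta x Q ->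
    (forall Q', M_n g theta x Q' ->
       (empirical_div phi Q <= empirical_div phi Q')%E) ->
    (D_n phi)° Q.
  move=> MQ Qmin; have QQ0 := Qmin _ MQ0; apply: contrapT => ndQ.
  have dQ : D_n phi Q by exact: le_lt_trans QQ0 (interior_subset dQ0).
  have := Q0_frontier Q; rewrite ltNge QQ0 => J_lt.
  suff : false by [].
  by apply: J_lt; split=> //; exact: subset_closure.
have dQs := min_interior _ MQs Qs_min.
have rQs i := interior_D_n_rdom n_gt0 div_phi i dQs.
have infE : ereal_inf [set empirical_div phi Q | Q in M_n g theta x]
    = empirical_div phi Qs.
  apply/eqP; rewrite eq_le; apply/andP; split.
    by apply: ereal_inf_lbound; exists Qs.
  by apply: le_ereal_inf_tmp => _ [Q MQ <-]; exact: Qs_min.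
exists Qs; split=> //.
- move=> Q MQ; rewrite infE => QsQ; apply: contrapT => /eqP Q_neq.
  have dQ : (D_n phi)° Q by apply: min_interior => //; rewrite -QsQ.
  have rQ i := interior_D_n_rdom n_gt0 div_phi i dQ.
  have half : 0 < (2^-1 : R) < 1 by lra.
  have := empirical_div_strict_convex n_gt0 div_phi half Q_neq rQ rQs.
  have -> : (2^-1%:E * empirical_div phi Q +
      (1 - 2^-1)%:E * empirical_div phi Qs = empirical_div phi Qs)%E.
    rewrite -QsQ (empirical_divE div_phi (fun i => interior_subset (rQs i))).
    by rewrite -!EFinM -EFinD -mulrDl addrC subrK mul1r.
  by rewrite ltNge Qs_min //; exact: M_n_convex.
have [c0 [c dphiE]] : exists (c0 : R) (c : 'I_l -> R), forall i,
    dphi phi (n%:R * Qs i ord0) = c0 + \sum_(j < l) c j * g (x i) theta j ord0.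
  apply: lagrange_multipliers => h h1 hg.
  apply: (first_order_condition n_gt0 div_phi dQs) => t.
  by apply: Qs_min; exact: M_n_translate.
exists c0, c => /=.
have invE i : dphi_inv phi (c0 + \sum_(j < l) c j * g (x i) theta j ord0)
    = n%:R * Qs i ord0.
  by rewrite -dphiE (dphi_invK div_phi).
have /M_nP[Qs1 Qsg] := MQs; split=> [i|i||j].
- by rewrite -dphiE; exists (n%:R * Qs i ord0).
- by rewrite invE mulKf.
- by rewrite (eq_bigr _ (fun i _ => invE i)) -mulr_sumr mulKf.
- rewrite mulr_sumr -[RHS](Qsg j); apply: eq_bigr => i _.
  by rewrite invE mulrCA mulKf // mulrC.
Qed.
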